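(* Let $\mathbb{F}$ be an algebraically closed field of characteristic $p>2$, let $m,n\ge 1$, and let $\lambda=(\lambda_1,\dots,\lambda_{2m+1})\in\mathbb{F}^{2m+1}$ be arbitrary. Let $\mathfrak{h}_{m,n}^\lambda$ be the restricted Heisenberg Lie superalgebra with even center whose basis is $\{x_1,\ldots,x_{2m},x_{2m+1}\mid y_1,\ldots,y_n\}$ (the $x_i$ even, the $y_j$ odd), whose non-zero brackets of basis elements are given by $[x_i,x_{m+i}]=[y_j,y_j]=x_{2m+1}$ for $1\le i\le m$, $1\le j\le n$ (together with those forced by super-antisymmetry), and whose $[p]$-operator is $\left(\sum_{i=1}^{2m+1}a_ix_i\right)^{[p]}=\left(\sum_{i=1}^{2m+1}a_i^p\lambda_i\right)x_{2m+1}$. Then the restricted 2-cohomology space with trivial coefficients has superdimension $$\mathrm{sdim}\, H^2_{res}(\mathfrak{h}_{m,n}^\lambda)=\left(2m^2+m+\frac{n^2+n}{2},\ 2mn\right),$$ and a basis of $H^2_{res}(\mathfrak{h}_{m,n}^\lambda)$ consists of the classes of the cocycles $$\{(x^{i,j},\widetilde{x^{i,j}})\mid 1\le i<j\le 2m\}\ \cup\ \{(x^i\wedge y^j,\widetilde{x^i\wedge y^j})\mid 1\le i\le 2m,\ 1\le j\le n\}$$ $$\cup\ \{(y^{i,j},\widetilde{y^{i,j}})\mid 1\le i<j\le n\}\ \cup\ \{(y^{i,i},\widetilde{y^{i,i}})\mid 1\le i\le n-1\}\ \cup\ \{(0,\overline{x}^i)\mid 1\le i\le 2m+1\}.$$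
   Context: Throughout, $\mathfrak{g}=\mathfrak{g}_{\bar 0}\oplus\mathfrak{g}_{\bar 1}$ is a finite-dimensional Lie superalgebra over $\mathbb{F}$ (for $p=3$ one also requires $[g,[g,g]]=0$ for all $g\in\mathfrak{g}_{\bar 1}$). $|g|$ denotes the parity of a homogeneous element $g$. Iterated brackets are left-normed: $[g_1,g_2,\ldots,g_j]=[[\ldots[[g_1,g_2],g_3],\ldots],g_j]$. Restricted Lie superalgebra: $\mathfrak{g}$ together with a map $[p]:\mathfrak{g}_{\bar 0}\to\mathfrak{g}_{\bar 0}$, $g\mapsto g^{[p]}$, making $\mathfrak{g}_{\bar 0}$ a restricted Lie algebra and such that $\mathfrak{g}_{\bar 1}$ is a restricted $\mathfrak{g}_{\bar 0}$-module under the bracket (i.e. $(\mathrm{ad}\,g)^p$ and $\mathrm{ad}\,g^{[p]}$ agree on $\mathfrak{g}_{\bar 1}$ for $g\in\mathfrak{g}_{\bar 0}$). Ordinary cochains (trivial coefficients): $C^1(\mathfrak{g})=\mathfrak{g}^*$ and $C^q(\mathfrak{g})=(\wedge^q\mathfrak{g})^*$ for $q=2,3$, where $\wedge$ is the super exterior power, so $g\wedge h=-(-1)^{|g||h|}h\wedge g$. For $\psi\in C^1(\mathfrak{g})$, $\varphi\in C^2(\mathfrak{g})$ and homogeneous $g,h,f$: $d^1(\psi)(g\wedge h)=\psi([g,h])$ and $$d^2(\varphi)(g\wedge h\wedge f)=\varphi([g,h]\wedge f)-(-1)^{|f||h|}\varphi([g,f]\wedge h)+(-1)^{|g|(|h|+|f|)}\varphi([h,f]\wedge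 g).$$ Compatibility: for $\varphi\in C^2(\mathfrak{g})$, a map $\omega:\mathfrak{g}_{\bar 0}\to\mathbb{F}$ is $\varphi$-compatible if $\omega(ag)=a^p\omega(g)$ and $$\omega(g+h)=\omega(g)+\omega(h)+\sum_{\substack{g_i\in\{g,h\}\\ g_1=g,\,g_2=h}}\frac{1}{\#(g)}\varphi([g_1,g_2,\ldots,g_{p-1}]\wedge g_p)$$ for all $a\in\mathbb{F}$, $g,h\in\mathfrak{g}_{\bar 0}$, where the sum is over all choices of $g_3,\ldots,g_p$ and $\#(g)$ is the number of factors $g_i$ equal to $g$. Given an ordered basis of $\mathfrak{g}_{\bar 0}$, for each $\varphi$ there is a unique $\varphi$-compatible map vanishing on all basis elements of $\mathfrak{g}_{\bar 0}$; it is denoted $\widetilde{\varphi}$. Here the basis is $x_1,\ldots,x_{2m+1}$. Restricted cochains: $C^1_{res}(\mathfrak{g})=C^1(\mathfrak{g})$, and $C^2_{res}(\mathfrak{g})=\{(\varphi,\omega)\mid\varphi\in C^2(\mathfrak{g}),\ \omega:\mathfrak{g}_{\bar 0}\to\mathbb{F}\text{ is }\varphi\text{-compatible}\}$. The differential is $d^1_{res}(\psi)=(d^1(\psi),\mathrm{ind}^1(\psi))$ with $\mathrm{ind}^1(\psi)(g)=\psi(g^{[p]})$ for $g\in\mathfrak{g}_{\bar 0}$, and $d^2_{res}(\varphi,\omega)=(d^2(\varphi),\mathrm{ind}^2(\varphi,\omega))$ with $$\mathrm{ind}^2(\varphi,\omega)(g,h)=\varphi(g\wedge h^{[p]})-\varphi([g,\underbrace{h,\ldots,h}_{p-1}]\wedge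 h),\qquad g\in\mathfrak{g},\ h\in\mathfrak{g}_{\bar 0}.$$ Then $H^2_{res}(\mathfrak{g})=\ker(d^2_{res})/\mathrm{im}(d^1_{res})$. The $\mathbb{Z}/2$-grading on $C^2_{res}(\mathfrak{g})$: the even part consists of the $(\varphi,\omega)$ with $\varphi$ even, the odd part of the $(\varphi,0)$ with $\varphi$ odd; $\mathrm{sdim}=(\text{dimension of even part},\text{dimension of odd part})$. Notation for cochains: $x^{i,j}$, $x^i\wedge y^j$, $y^{i,j}$ denote the elements of $C^2(\mathfrak{g})$ dual to the basis elements $x_i\wedge x_j$ ($i<j$), $x_i\wedge y_j$, $y_i\wedge y_j$ ($i\le j$) of $\wedge^2\mathfrak{g}$. The map $\overline{x}^i:\mathfrak{g}_{\bar 0}\to\mathbb{F}$ is $\overline{x}^i\left(\sum_j a_jx_j\right)=a_i^p$. *)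

(* Defs.v *)
From HB Require Import structures.
From mathcomp Require Import all_boot all_order all_algebra.
From mathcomp Require Import ring.
From mathcomp Require Import boolp classical_sets functions.

Set Implicit Arguments.
Unset Strict Implicit.
Unset Printing Implicit Defensive.

Import GRing.Theory.
Local Open Scope ring_scope.
Local Open Scope quotient_scope.
Local Open Scope classical_set_scope.

Section QuotientSpace.
Variables (F : fieldType) (V : lmodType F) (B : {pred V}).
Variable B_closed : submod_closed B.

(* An alias of [B] carrying the proof, for inference of closure instances. *)
Definition closed_pred of submod_closed B : {pred V} := B.
Local Notation B' := (closed_pred B_closed).

HB.instance Definition _ := GRing.isSubmodClosed.Build F V B' B_closed.

Definition quotient_space := Quotient.quot B'.

HB.instance Definition _ := GRing.Zmodule.on quotient_space.

Definition proj : V -> quotient_space := \pi_quotient_space.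

Lemma projB : {morph proj : u v / u - v}.
Proof. by move=> u v; rewrite /proj !piE. Qed.

Lemma projD : {morph proj : u v / u + v}.
Proof. by move=> u v; rewrite /proj !piE. Qed.

Lemma proj_eq u v : (proj u = proj v) <-> (u - v \in B).
Proof.
rewrite /proj; change (u - v \in B) with (u - v \in B').
by rewrite Quotient.idealrBE; split=> [->//|/eqP].
Qed.

Lemma proj_repr x : proj (repr x) = x.
Proof. exact: reprK. Qed.

Definition quotient_scale (a : F) (x : quotient_space) : quotient_space :=
  proj (a *: repr x).

Lemma projZ a v : quotient_scale a (proj v) = proj (a *: v).
Proof.
apply/proj_eq; rewrite -scalerBr -(addr0 (a *: _)).
have [B0 BZD] := B_closed; apply: BZD => //; exact/proj_eq/proj_repr.
Qed.

Fact quotient_scaleA a b x :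
  quotient_scale a (quotient_scale b x) = quotient_scale (a * b) x.
Proof. by rewrite -[x]proj_repr !projZ scalerA. Qed.

Fact quotient_scale1 : left_id 1 quotient_scale.
Proof. by move=> x; rewrite -[x]proj_repr projZ scale1r. Qed.

Fact quotient_scaleDr : right_distributive quotient_scale +%R.
Proof.
move=> a x y.
by rewrite -[x]proj_repr -[y]proj_repr -projD !projZ scalerDr projD.
Qed.

Fact quotient_scaleDl x : {morph quotient_scale^~ x : a b / a + b}.
Proof. by move=> a b; rewrite -[x]proj_repr !projZ scalerDl projD. Qed.

HB.instance Definition _ := GRing.Zmodule_isLmodule.Build F quotient_space
  quotient_scaleA quotient_scale1 quotient_scaleDr quotient_scaleDl.

Fact proj_is_linear : linear proj.
Proof. by move=> a u v; rewrite projD -projZ. Qed.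

HB.instance Definition _ := GRing.isLinear.Build F V quotient_space *:%R proj
  proj_is_linear.

End QuotientSpace.

Section Bases.
Variables (F : fieldType) (W : lmodType F).

(* [S] is meant to be a linear subspace; [W] need not be finite-dimensional,
   which is why [vector.basis_of] does not apply. *)
Definition is_basis (S : set W) (s : seq W) :=
  [/\ forall w, w \in s -> S w,
      forall c : 'I_(size s) -> F,
        \sum_(i < size s) c i *: s`_i = 0 -> forall i, c i = 0 &
      forall w, S w ->
        exists c : 'I_(size s) -> F, w = \sum_(i < size s) c i *: s`_i].

Definition has_dim (S : set W) (d : nat) :=
  exists2 s : seq W, is_basis S s & size s = d.

End Bases.

(* A superspace is a pair (U0, U1), with underlying space U0 * U1.
   Parities are booleans: [false] is even and [true] is odd. *)
Definition homogeneous (F : fieldType) (U0 U1 : vectType F) (a : bool)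
    (u : U0 * U1) : Prop :=
  if a then u.1 = 0 else u.2 = 0.

Definition component (F : fieldType) (U0 U1 : vectType F) (a : bool)
    (u : U0 * U1) : U0 * U1 :=
  if a then (0, u.2) else (u.1, 0).

Record lieSuperalgebra (F : fieldType) := LieSuperalgebra {
  even_part : vectType F;
  odd_part : vectType F;
  bracket : even_part * odd_part -> even_part * odd_part ->
            even_part * odd_part;
  bracket_linearl : forall v, linear (bracket^~ v);
  bracket_linearr : forall u, linear (bracket u);
  bracket_graded : forall a b u v, homogeneous a u -> homogeneous b v ->
    homogeneous (a (+) b) (bracket u v);
  bracket_skew : forall a b u v, homogeneous a u -> homogeneous b v ->
    bracket u v = - ((-1) ^+ (a && b) *: bracket v u);
  bracket_jacobi : forall a b u v w, homogeneous a u -> homogeneous b v ->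
    bracket u (bracket v w) =
    bracket (bracket u v) w + (-1) ^+ (a && b) *: bracket v (bracket u w);
  bracket_cubic : (3 \in [pchar F])%N ->
    forall u, homogeneous true u -> bracket u (bracket u u) = 0
}.

Definition carrier (F : fieldType) (L : lieSuperalgebra F) : vectType F :=
  (even_part L * odd_part L)%type.
Coercion carrier : lieSuperalgebra >-> vectType.

Section Words.
Variables (F : fieldType) (L : lieSuperalgebra F).

Definition ev (g : even_part L) : L := (g, 0).

Fixpoint lnbr_from (u : L) (s : seq L) : L :=
  if s is v :: s' then lnbr_from (bracket u v) s' else u.

(* [[g_1, g_2, ..., g_j]], left-normed *)
Definition lnbr (s : seq L) : L :=
  if s is u :: s' then lnbr_from u s' else 0.

(* The sum of (1 / #(g)) f([:: g_1; ...; g_p]) over all words g_1 ... g_p in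
   {g, h} with g_1 = g and g_2 = h.  A word is encoded by a p-tuple of booleans,
   [true] standing for g; thus #(g) = count id c. *)
Definition word_sum (p : nat) (W : lmodType F) (g h : even_part L)
    (f : seq L -> W) : W :=
  \sum_(c : p.-tuple bool | nth false c 0 && ~~ nth true c 1)
    ((count id c)%:R : F)^-1 *: f [seq (if b then ev g else ev h) | b <- c].

End Words.

(* [pmapD] is Jacobson's formula: the sum over i of s_i(g, h), where i s_i(g, h)
   is the coefficient of t^(i-1) in ad(t g + h)^(p-1) (g).
   [ad_pmap] is required on the whole of L: on the even part it belongs to the
   definition of a restricted Lie algebra, and on the odd part to that of a
   restricted module. *)
Record restrictedLieSuperalgebra (F : fieldType) (p : nat) :=
  RestrictedLieSuperalgebra {
  underlying :> lieSuperalgebra F;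
  pmap : even_part underlying -> even_part underlying;
  pmapZ : forall a g, pmap (a *: g) = a ^+ p *: pmap g;
  ad_pmap : forall g (u : underlying),
    bracket (ev (pmap g)) u = iter p (bracket (ev g)) u;
  pmapD : forall g h, ev (pmap (g + h)) =
    ev (pmap g) + ev (pmap h) + word_sum p g h (@lnbr F underlying)
}.

Section Cohomology.
Variables (F : fieldType) (p : nat) (L : restrictedLieSuperalgebra F p).

Local Notation cochain1 := 'Hom(L, F^o).
Local Notation form2 := (L -> L -> F^o).

(* The space of all pairs (phi, omega) of functions; the restricted cochains
   are the pairs in [C2res] below. *)
Definition precochain2 : lmodType F :=
  (form2 * (even_part L -> F^o))%type.

(* Elements of the dual of the second super exterior power, seen as bilinear
   forms: phi u v is the value at u /\ v. *)
Definition C2 (phi : form2) : Prop :=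
  [/\ forall v, scalar (phi^~ v), forall u, scalar (phi u) &
      forall a b u v, homogeneous a u -> homogeneous b v ->
        phi u v = - ((-1) ^+ (a && b) * phi v u)].

Definition form_parity (e : bool) (phi : form2) : Prop :=
  forall a b u v, homogeneous a u -> homogeneous b v ->
    a (+) b != e -> phi u v = 0.

Definition compatible (phi : form2) (omega : even_part L -> F^o) : Prop :=
  (forall a g, omega (a *: g) = a ^+ p * omega g) /\
  (forall g h, omega (g + h) = omega g + omega h +
     word_sum p g h (fun s => phi (lnbr (take p.-1 s)) (nth 0 s p.-1))).

Lemma compatible_unique (b : seq (even_part L)) phi omega omega' :
  (0 < p)%N -> (<<b>> = fullv)%VS -> compatible phi omega -> compatible phi omega' ->
  (forall g, g \in b -> omega g = omega' g) -> omega = omega'.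
Proof.
move=> p0 bT [oZ oD] [oZ' oD'] eqb; apply/funext => g.
have : g \in (<<in_tuple b>>)%VS by rewrite /= bT memvf.
move=> /coord_span -> /=.
elim/big_rec: _ => [|i h _ IH]; last first.
  by rewrite oD oD' oZ oZ' IH eqb // mem_nth.
by rewrite -(scale0r 0) oZ oZ' expr0n gtn_eqF // !mul0r.
Qed.

(* The phi-compatible map vanishing on the basis [b] of the even part; it is
   unique by [compatible_unique].  The default value 0 of [xget] is returned
   if there is none: for p = 3 a phi with d2 phi <> 0 may have no compatible
   map.  [Z2res (with_tilde b phi)] includes compatibility. *)
Definition tilde (b : seq (even_part L)) (phi : form2) :
    even_part L -> F^o :=
  xget 0 [set omega | compatible phi omega /\ forall g, g \in b -> omega g = 0].

Definition with_tilde (b : seq (even_part L)) (phi : form2) : precochain2 :=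
  (phi, tilde b phi).

Definition C2res (c : precochain2) : Prop := C2 c.1 /\ compatible c.1 c.2.

Definition C2res_part (e : bool) (c : precochain2) : Prop :=
  [/\ C2res c, form_parity e c.1 & e -> c.2 = 0].

Definition d1 (psi : cochain1) : form2 := fun u v => psi (bracket u v).

Definition ind1 (psi : cochain1) : even_part L -> F^o :=
  fun g => psi (ev (pmap g)).

Definition d1res (psi : cochain1) : precochain2 := (d1 psi, ind1 psi).

Definition d2_homogeneous (phi : form2) (a b c : bool) (u v w : L) : F :=
  phi (bracket u v) w
  - (-1) ^+ (c && b) * phi (bracket u w) v
  + (-1) ^+ (a && (b (+) c)) * phi (bracket v w) u.

Definition d2 (phi : form2) (u v w : L) : F :=
  \sum_(a : bool) \sum_(b : bool) \sum_(c : bool)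
    d2_homogeneous phi a b c (component a u) (component b v) (component c w).

Definition ind2 (phi : form2) (g : L) (h : even_part L) : F :=
  phi g (ev (pmap h)) - phi (lnbr (g :: nseq p.-1 (ev h))) (ev h).

(* ind2 does not depend on the second component of the cochain. *)
Definition Z2res (c : precochain2) : Prop :=
  [/\ C2res c, forall u v w, d2 c.1 u v w = 0 & forall g h, ind2 c.1 g h = 0].

Definition B2res : {pred precochain2} :=
  [pred c | `[< exists psi, c = d1res psi >]].

Fact B2res_submod_closed : submod_closed B2res.
Proof.
split=> [|a u v].
  apply/asboolP; exists 0; congr pair.
    by apply/funext=> u; apply/funext=> v; rewrite /d1 lfunE.
  by apply/funext=> g; rewrite /ind1 lfunE.
move=> /asboolP[psi ->] /asboolP[psi' ->].
apply/asboolP; exists (a *: psi + psi'); congr pair.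
  by apply/funext=> x; apply/funext=> y; rewrite /d1 add_lfunE scale_lfunE.
by apply/funext=> g; rewrite /ind1 add_lfunE scale_lfunE.
Qed.

Definition H2res_ambient : lmodType F := quotient_space B2res_submod_closed.

Definition cls (c : precochain2) : H2res_ambient := proj B2res_submod_closed c.

(* ker(d2res) / im(d1res), inside the quotient of all pairs by im(d1res). *)
Definition H2res : set H2res_ambient := [set cls c | c in Z2res].

Definition H2res_part (e : bool) : set H2res_ambient :=
  [set cls c | c in [set c | Z2res c /\ C2res_part e c]].

Definition sdim_H2res (d : nat * nat) : Prop :=
  has_dim (H2res_part false) d.1 /\ has_dim (H2res_part true) d.2.

End Cohomology.

Arguments H2res {F p} L.
Arguments H2res_part {F p} L e.

(* The coboundaries are cocycles, so that H2res is indeed the quotient of the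
   latter by the former. *)
Section Coboundaries.
Variables (F : fieldType) (p : nat) (L : restrictedLieSuperalgebra F p).
Hypothesis p_gt2 : (2 < p)%N.
Hypothesis charFp : p \in [pchar F].

Lemma bracketDl (u u' v : L) :
  bracket (u + u') v = bracket u v + bracket u' v.
Proof. by have /= := bracket_linearl v 1 u u'; rewrite !scale1r. Qed.

Lemma bracketDr (u v v' : L) :
  bracket u (v + v') = bracket u v + bracket u v'.
Proof. by have /= := bracket_linearr u 1 v v'; rewrite !scale1r. Qed.

Lemma bracketZr a (u v : L) : bracket u (a *: v) = a *: bracket u v.
Proof.
have /= := bracket_linearr u a v 0; rewrite addr0 => ->.
suff -> : bracket u (0 : L) = 0 by rewrite addr0.
by have /= := bracket_linearr u (-1) 0 0; rewrite scaler0 addr0 scaleN1r addNr.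
Qed.

Lemma component_homogeneous a (u : L) : homogeneous a (component a u).
Proof. by case: a. Qed.

Lemma componentD (u : L) : u = component false u + component true u.
Proof.
by case: u => u0 u1; rewrite /component; congr pair; rewrite /= ?addr0 ?add0r.
Qed.

Lemma bracket_ev (u : L) g : bracket u (ev g) = - bracket (ev g) u.
Proof.
have hg : homogeneous false (ev g) by [].
rewrite [u]componentD bracketDl bracketDr opprD.
rewrite (bracket_skew (component_homogeneous false u) hg).
by rewrite (bracket_skew (component_homogeneous true u) hg) !scale1r.
Qed.

Lemma lnbr_from_rcons (u v : L) s :
  lnbr_from u (rcons s v) = bracket (lnbr_from u s) v.
Proof. by elim: s u => //= w s IHs u. Qed.

Lemma lnbr_last (s : seq L) k : size s = k -> (1 < k)%N ->
  lnbr s = bracket (lnbr (take k.-1 s)) (nth 0 s k.-1).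
Proof.
case/lastP: s => [<-//|s v]; rewrite size_rcons => <- /=.
rewrite nth_rcons ltnn eqxx -cats1 take_size_cat //.
by case: s => // u s _; rewrite /= cats1 lnbr_from_rcons.
Qed.

Lemma rcons_nseq (T : Type) k (x : T) : rcons (nseq k x) x = nseq k.+1 x.
Proof. by elim: k => //= k ->. Qed.

Lemma lnbr_nseq (u : L) g k :
  lnbr_from u (nseq k (ev g)) = (-1) ^+ k *: iter k (bracket (ev g)) u.
Proof.
elim: k => [|k IHk]; first by rewrite scale1r.
by rewrite -rcons_nseq lnbr_from_rcons IHk bracket_ev bracketZr exprS mulN1r scaleNr.
Qed.

Lemma d1res_C2res (psi : 'Hom(L, F^o)) : C2res (L := L) (d1res psi).
Proof.
split; split.
- by move=> v a u u'; rewrite /= /d1 (bracket_linearl v a u u') linearP.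
- by move=> u a v v'; rewrite /= /d1 (bracket_linearr u a v v') linearP.
- move=> a b u v hu hv.
  by rewrite /= /d1 (bracket_skew hu hv) linearN linearZ.
- move=> a g; rewrite /= /ind1 pmapZ.
  have -> : ev (a ^+ p *: pmap g) = a ^+ p *: ev (pmap g) :> L.
    by rewrite /ev; congr pair; rewrite /= scaler0.
  by rewrite linearZ.
move=> g h; rewrite /= /ind1 pmapD !linearD; congr (_ + _).
rewrite /word_sum linear_sum; apply: eq_bigr => c _; rewrite linearZ /=.
congr (_ * _); rewrite /d1 -lnbr_last ?size_map ?size_tuple //.
exact: ltnW.
Qed.

Lemma d2_d1 (psi : 'Hom(L, F^o)) u v w : d2 (L := L) (d1 psi) u v w = 0.
Proof.
rewrite /d2 big1 // => a _; rewrite big1 // => b _; rewrite big1 // => c _.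
move: (component_homogeneous a u) (component_homogeneous b v).
move: (component_homogeneous c w) => hw hu hv.
move: (component a u) (component b v) (component c w) hu hv hw.
move=> {}u {}v {}w hu hv hw; rewrite /d2_homogeneous /d1.
rewrite (bracket_skew (bracket_graded hv hw) hu).
rewrite (bracket_skew (bracket_graded hu hw) hv) (bracket_jacobi w hu hv).
rewrite !(linearN, linearD, linearZ) /=.
by case: a b c {hu hv hw} => [] [] []; rewrite /= ?expr0 ?expr1 ?scale1r ?scaleN1r; ring.
Qed.

Lemma ind2_d1 (psi : 'Hom(L, F^o)) g h : ind2 (L := L) (d1 psi) g h = 0.
Proof.
rewrite /ind2 /d1 /= -lnbr_from_rcons rcons_nseq prednK; last exact: ltnW (ltnW _).
rewrite lnbr_nseq bracket_ev ad_pmap.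
have p_odd : odd p by case: (even_prime (pcharf_prime charFp)) p_gt2 => [->|].
by rewrite -signr_odd p_odd expr1 scaleN1r subrr.
Qed.

Lemma d1res_Z2res (psi : 'Hom(L, F^o)) : Z2res (L := L) (d1res psi).
Proof. by split; [exact: d1res_C2res|exact: d2_d1|exact: ind2_d1]. Qed.

End Coboundaries.

Section Heisenberg.
Variables (F : fieldType) (m n : nat).

(* The even part is F^(2m+1), the odd part F^n. With 0-based indices, the
   paper's x_i and x_(m+i), for i <= m, have indices
   [xidx (lshift m i)] and [xidx (rshift m i)]; x_(2m+1) has index [zidx]. *)
Local Notation H0 := 'rV[F]_(m + m + 1).
Local Notation H1 := 'rV[F]_n.
Local Notation H := (H0 * H1)%type.

Definition xidx (i : 'I_(m + m)) : 'I_(m + m + 1) := lshift 1 i.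
Definition zidx : 'I_(m + m + 1) := rshift (m + m) ord0.

Definition x_ (i : 'I_(m + m + 1)) : H0 := delta_mx 0 i.
Definition y_ (j : 'I_n) : H1 := delta_mx 0 j.

(* The coordinates of u with respect to the x_i and to the y_j. *)
Definition xc (i : 'I_(m + m + 1)) (u : H) : F := u.1 0 i.
Definition yc (j : 'I_n) (u : H) : F := u.2 0 j.

Definition heis_form (u v : H) : F :=
  \sum_(i < m) (xc (xidx (lshift m i)) u * xc (xidx (rshift m i)) v
              - xc (xidx (rshift m i)) u * xc (xidx (lshift m i)) v)
  + \sum_(j < n) yc j u * yc j v.

Definition heis_bracket (u v : H) : H := (heis_form u v *: x_ zidx, 0).

Lemma xcD i a u v : xc i (a *: u + v) = a * xc i u + xc i v.
Proof. by rewrite /xc !mxE. Qed.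

Lemma ycD j a u v : yc j (a *: u + v) = a * yc j u + yc j v.
Proof. by rewrite /yc !mxE. Qed.

Lemma heis_form_linearl v : scalar (heis_form^~ v).
Proof.
move=> a u u'; rewrite /heis_form mulrDr addrACA !mulr_sumr -!big_split /=.
congr (_ + _); apply: eq_bigr => i _; rewrite ?xcD ?ycD.
  by rewrite !mulrDl mulrBr opprD addrACA !mulrA.
by rewrite mulrDl mulrA.
Qed.

Lemma heis_form_linearr u : scalar (heis_form u).
Proof.
move=> a v v'; rewrite /heis_form mulrDr addrACA !mulr_sumr -!big_split /=.
congr (_ + _); apply: eq_bigr => i _; rewrite ?xcD ?ycD.
  by rewrite !mulrDr mulrN opprD addrACA !(mulrCA a).
by rewrite mulrDr mulrCA.
Qed.

Fact heis_bracket_linearl v : linear (heis_bracket^~ v).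
Proof.
move=> a u u'; rewrite /heis_bracket heis_form_linearl scalerDl -scalerA.
by congr pair; rewrite /= scaler0 addr0.
Qed.

Fact heis_bracket_linearr u : linear (heis_bracket u).
Proof.
move=> a v v'; rewrite /heis_bracket heis_form_linearr scalerDl -scalerA.
by congr pair; rewrite /= scaler0 addr0.
Qed.

Lemma xc_odd i (u : H) : homogeneous true u -> xc i u = 0.
Proof. by rewrite /xc /= => ->; rewrite mxE. Qed.

Lemma yc_even j (u : H) : homogeneous false u -> yc j u = 0.
Proof. by rewrite /yc /= => ->; rewrite mxE. Qed.

Lemma heis_form_even (u v : H) : homogeneous false u -> homogeneous true v ->
  heis_form u v = 0.
Proof.
move=> hu hv; rewrite /heis_form !big1 ?addr0 // => i _.
  by rewrite yc_even ?mul0r.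
by rewrite !(xc_odd _ hv) !mulr0 subrr.
Qed.

Lemma heis_form_skew a b (u v : H) : homogeneous a u -> homogeneous b v ->
  heis_form u v = - ((-1) ^+ (a && b) * heis_form v u).
Proof.
have E (u' v' : H) : homogeneous true u' -> homogeneous false v' ->
    heis_form u' v' = 0.
  move=> hu hv; rewrite /heis_form !big1 ?addr0 // => i _.
    by rewrite (yc_even _ hv) ?mulr0.
  by rewrite !(xc_odd _ hu) !mul0r subrr.
case: a; case: b => hu hv; rewrite ?expr1 ?expr0 ?mul1r ?mulN1r ?opprK.
- rewrite /heis_form; congr (_ + _).
    by rewrite !big1 // => i _; rewrite !(xc_odd _ hu) !(xc_odd _ hv) !mulr0 subrr.
  by apply: eq_bigr => i _; rewrite mulrC.
- by rewrite E // heis_form_even // oppr0.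
- by rewrite heis_form_even // E // oppr0.
rewrite /heis_form opprD -!sumrN; congr (_ + _); apply: eq_bigr => i _.
  by rewrite opprB ![xc _ v * _]mulrC.
by rewrite !(yc_even _ hu) !mul0r mulr0 oppr0.
Qed.

Fact heis_bracket_graded a b (u v : H) : homogeneous a u -> homogeneous b v ->
  homogeneous (a (+) b) (heis_bracket u v).
Proof.
case: a; case: b => hu hv //=; last first.
  by rewrite heis_form_even // scale0r.
by rewrite (heis_form_skew hu hv) heis_form_even // mulr0 oppr0 scale0r.
Qed.

Fact heis_bracket_skew a b (u v : H) : homogeneous a u -> homogeneous b v ->
  heis_bracket u v = - ((-1) ^+ (a && b) *: heis_bracket v u).
Proof.
move=> hu hv; rewrite /heis_bracket (heis_form_skew hu hv) scaleNr -scalerA.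
by congr pair; rewrite /= scaler0 oppr0.
Qed.

Lemma heis_formz (a : F) (u : H) : heis_form u (a *: x_ zidx, 0) = 0.
Proof.
have X i : xc (xidx i) (a *: x_ zidx, 0) = 0.
  by rewrite /xc /x_ !mxE eqxx eq_lrshift mulr0.
rewrite /heis_form !big1 ?addr0 // => i _; first by rewrite /yc mxE mulr0.
by rewrite !X !mulr0 subrr.
Qed.

Lemma heis_zform (a : F) (u : H) : heis_form (a *: x_ zidx, 0) u = 0.
Proof.
have X i : xc (xidx i) (a *: x_ zidx, 0) = 0.
  by rewrite /xc /x_ !mxE eqxx eq_lrshift mulr0.
rewrite /heis_form !big1 ?addr0 // => i _; first by rewrite /yc mxE mul0r.
by rewrite !X !mul0r subrr.
Qed.

Lemma heis_bracketz (a : F) (u : H) : heis_bracket u (a *: x_ zidx, 0) = 0.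
Proof. by rewrite /heis_bracket heis_formz scale0r. Qed.

Lemma heis_zbracket (a : F) (u : H) : heis_bracket (a *: x_ zidx, 0) u = 0.
Proof. by rewrite /heis_bracket heis_zform scale0r. Qed.

Fact heis_bracket_jacobi a b (u v w : H) :
  homogeneous a u -> homogeneous b v ->
  heis_bracket u (heis_bracket v w) = heis_bracket (heis_bracket u v) w
    + (-1) ^+ (a && b) *: heis_bracket v (heis_bracket u w).
Proof. by move=> _ _; rewrite !heis_bracketz heis_zbracket scaler0 addr0. Qed.

Fact heis_bracket_cubic : (3 \in [pchar F])%N ->
  forall u : H, homogeneous true u -> heis_bracket u (heis_bracket u u) = 0.
Proof. by move=> _ u _; rewrite heis_bracketz. Qed.

Definition heisenberg_lie : lieSuperalgebra F :=
  @LieSuperalgebra F H0 H1 heis_bracket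
    heis_bracket_linearl heis_bracket_linearr heis_bracket_graded
    heis_bracket_skew heis_bracket_jacobi heis_bracket_cubic.

Lemma xc_x i k : xc i (x_ k, 0) = (k == i)%:R.
Proof. by rewrite /xc /x_ mxE eqxx eq_sym. Qed.

Lemma yc_y j k : yc j (0, y_ k) = (k == j)%:R.
Proof. by rewrite /yc /y_ mxE eqxx eq_sym. Qed.

Lemma heis_bracket_basis_xx (i j : 'I_(m + m + 1)) :
  heis_bracket (x_ i, 0) (x_ j, 0) =
  ((((i < m) && (j == m + i :> nat))%N%:R
    - ((j < m) && (i == m + j :> nat))%N%:R) *: x_ zidx, 0).
Proof.
have E (a b : 'I_(m + m + 1)) : \sum_(k < m) xc (xidx (lshift m k)) (x_ a, 0)
      * xc (xidx (rshift m k)) (x_ b, 0)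
    = ((a < m) && (b == m + a :> nat))%N%:R.
  have D k : xc (xidx (lshift m k)) (x_ a, 0) * xc (xidx (rshift m k)) (x_ b, 0)
      = ((a == k :> nat) && (b == m + k :> nat))%N%:R.
    by rewrite !xc_x -natrM mulnb.
  rewrite (eq_bigr _ (fun k _ => D k)).
  have [am|ma] := ltnP a m; last first.
    by rewrite big1 // => k _; rewrite gtn_eqF // (leq_trans (ltn_ord k)).
  rewrite (bigD1 (Ordinal am)) //= eqxx big1 ?addr0 // => k.
  by rewrite -val_eqE eq_sym => /negPf ->.
rewrite /heis_bracket /heis_form [X in _ + X]big1 ?addr0 => [|k _]; last first.
  by rewrite /yc mxE mul0r.
rewrite sumrB E; congr ((_ - _) *: _, _); rewrite -E.
by apply: eq_bigr => k _; rewrite mulrC.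
Qed.

Lemma heis_bracket_basis_xy i j : heis_bracket (x_ i, 0) (0, y_ j) = 0.
Proof. by rewrite /heis_bracket heis_form_even // scale0r. Qed.

Lemma heis_bracket_basis_yy i j :
  heis_bracket (0, y_ i) (0, y_ j) = ((i == j)%:R *: x_ zidx, 0).
Proof.
rewrite /heis_bracket /heis_form big1 ?add0r => [|k _]; last first.
  by rewrite /xc !mxE !mul0r subrr.
rewrite (bigD1 i) //= big1 ?addr0 => [|k ki]; rewrite !yc_y.
  by rewrite eqxx mul1r eq_sym.
by rewrite eq_sym (negPf ki) mul0r.
Qed.

(* The cochains dual to the basis elements x_i /\ x_j (i < j), x_i /\ y_j and
   y_i /\ y_j (i <= j), as bilinear forms. In the last case i = j is apart:
   the general formula would give 2 at y_i /\ y_i. *)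
Definition dual_xx (i j : 'I_(m + m + 1)) (u v : H) : F^o :=
  xc i u * xc j v - xc j u * xc i v.
Definition dual_xy (i : 'I_(m + m + 1)) (j : 'I_n) (u v : H) : F^o :=
  xc i u * yc j v - yc j u * xc i v.
Definition dual_yy (i j : 'I_n) (u v : H) : F^o :=
  if i == j then yc i u * yc i v else yc i u * yc j v + yc j u * yc i v.

Variables (p : nat) (lam : 'rV[F]_(m + m + 1)).

Definition xbar (i : 'I_(m + m + 1)) (g : H0) : F^o := g 0 i ^+ p.

Definition heis_pmap (g : H0) : H0 :=
  (\sum_i g 0 i ^+ p * lam 0 i) *: x_ zidx.

Fact heis_pmapZ a g : heis_pmap (a *: g) = a ^+ p *: heis_pmap g.
Proof.
rewrite /heis_pmap scalerA mulr_sumr; congr (_ *: _).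
by apply: eq_bigr => i _; rewrite mxE exprMn mulrA.
Qed.

Hypothesis p_gt2 : (2 < p)%N.

Fact heis_ad_pmap g (u : heisenberg_lie) :
  bracket (ev (L := heisenberg_lie) (heis_pmap g)) u =
  iter p (bracket (ev (L := heisenberg_lie) g)) u.
Proof.
case: p p_gt2 => [|[|q]] // _.
by rewrite [LHS]heis_zbracket iterS [RHS]heis_bracketz.
Qed.

Lemma heis_lnbr_from0 (s : seq heisenberg_lie) :
  lnbr_from (0 : heisenberg_lie) s = 0.
Proof.
elim: s => //= v s IHs; rewrite -[X in lnbr_from X](_ : 0 = _) //.
by have := heis_zbracket 0 v; rewrite scale0r => ->.
Qed.

(* L is nilpotent of class 2. *)
Lemma heis_lnbr0 (s : seq heisenberg_lie) : (2 < size s)%N -> lnbr s = 0.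
Proof.
case: s => [|u [|v [|w s]]] //= _.
rewrite -[RHS](heis_lnbr_from0 s); congr (lnbr_from _ s).
exact: heis_zbracket.
Qed.

Hypothesis charFp : p \in [pchar F].

Fact heis_pmapD (g h : even_part heisenberg_lie) :
  ev (L := heisenberg_lie) (heis_pmap (g + h)) =
  ev (L := heisenberg_lie) (heis_pmap g) + ev (L := heisenberg_lie) (heis_pmap h)
  + word_sum p g h (@lnbr F heisenberg_lie).
Proof.
rewrite [word_sum _ _ _ _]big1 ?addr0 => [|c _]; last first.
  by rewrite heis_lnbr0 ?scaler0 // size_map size_tuple.
rewrite /ev; congr pair; rewrite /= ?addr0 // /heis_pmap -scalerDl.
rewrite -big_split /=; congr (_ *: _); apply: eq_bigr => i _.
by rewrite mxE -mulrDl -!(pFrobenius_autE charFp) rmorphD.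
Qed.

Definition heisenberg : restrictedLieSuperalgebra F p :=
  @RestrictedLieSuperalgebra F p heisenberg_lie heis_pmap
    heis_pmapZ heis_ad_pmap heis_pmapD.

Definition xbasis : seq (even_part heisenberg) :=
  [seq x_ i | i <- enum 'I_(m + m + 1)].

End Heisenberg.

(* Main.v *)
Require Import Defs.
From HB Require Import structures.
From mathcomp Require Import all_boot all_order all_algebra.
From mathcomp Require Import ring zify.
From mathcomp Require Import boolp classical_sets functions.

Set Implicit Arguments.
Unset Strict Implicit.
Unset Printing Implicit Defensive.

Import GRing.Theory.
Local Open Scope ring_scope.

(** Every bracket of [h] is a multiple of the central element z, so a bilinear
    form [phi] enters [d2] only through its values at z, and
      d2 phi (y, y, x) = phi (z, x),   d2 phi (x_i, x_(m+i), y) = phi (z, y)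
    for the even x and the odd y of the basis; both identities are available
    because there is an i and there is a y.  Hence [phi] is closed exactly
    when it kills z ([d2_eq0]).  For such a [phi], the word sum in the
    compatibility condition vanishes, as p > 2 makes the first argument of
    [phi] a bracket; so does [ind2], as [h] is nilpotent of class 2 and the
    p-map has central values.  A restricted 2-cocycle is therefore a pair of an
    arbitrary super-alternating form on h / z and an arbitrary p-semilinear map
    on the even part, with no relation between the two ([Z2resE]), and the
    compatible map that vanishes on the basis is 0 ([with_tildeE]).

    The pairs [cocycle t] given by the dual forms and by the maps [xbar] are
    then a basis of the cocycles.  Their coordinates [coef t] are values at
    basis vectors: they form a dual family ([coef_cocycle],
    [coef_cocycle_neq]), and a cocycle whose coordinates all vanish is 0
    ([coef_inj]).

    The differential of [psi] is psi(z) times one fixed pair, [heis_cobord],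
    made of the form that defines the bracket and of the coefficient of the
    p-map ([d1res_heis]).  So the coboundaries are a line, and since
    [heis_cobord] has coordinate 1 at the square of any chosen odd coordinate,
    exchange removes that single square from the basis and the classes of all
    the others are a basis of the quotient ([quotient_basis]).  The line is
    even, so the same argument applied to the even and to the odd cocycles
    gives the two dimensions ([part_basis]), the odd ones losing nothing. *)

(** * Bases of a quotient by a line *)

Section BasisOfQuotient.
Variable F : fieldType.

(** Indexing a basis by its labels instead of by positions: sums over the
    labels can then be split by membership, and dual families make sense. *)
Lemma is_basis_map (W : lmodType F) (T : eqType) (S : set W) (g : T -> W)
    (s : seq T) :
  uniq s ->
  (forall t, t \in s -> S (g t)) ->
  (forall a : T -> F, \sum_(t <- s) a t *: g t = 0 ->
     forall t, t \in s -> a t = 0) ->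
  (forall w, S w -> exists a : T -> F, w = \sum_(t <- s) a t *: g t) ->
  is_basis S [seq g t | t <- s].
Proof.
case: s => [|x0 s'] s_uniq Sg g_free g_span.
  split=> [//|c _ []//|w /g_span[a ->]].
  by exists (fun=> 0); rewrite big_nil big_ord0.
move: (x0 :: s') s_uniq Sg g_free g_span => {s'} s s_uniq Sg g_free g_span.
have lt_s (i : 'I_(size [seq g t | t <- s])) : (i < size s)%N.
  by rewrite -(size_map g) ltn_ord.
have sumE (a : T -> F) (c : 'I_(size [seq g t | t <- s]) -> F) :
    (forall i, c i = a (nth x0 s i)) ->
    \sum_(t <- s) a t *: g t = \sum_(i < size [seq g t | t <- s])
      c i *: [seq g t | t <- s]`_i.
  move=> ac; rewrite (big_nth x0) -(size_map g s) big_mkord.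
  by apply: eq_bigr => i _; rewrite (nth_map x0) // ac.
split=> [_ /mapP[t ts ->]|c c0 i|w /g_span[a ->]]; first exact: Sg.
  pose a t := if insub (index t s) is Some j then c j else 0.
  have ac j : c j = a (nth x0 s j) by rewrite /a index_uniq // valK.
  by rewrite ac; apply: g_free; rewrite ?mem_nth // (sumE a c ac).
by exists (fun i => a (nth x0 s i)); apply: sumE.
Qed.

Lemma scalar_fun0 (V : lmodType F) (l : V -> F^o) : scalar l -> l 0 = 0.
Proof. by move=> lP; have := lP (-1) 0 0; rewrite scaler0 addr0 mulN1r addNr. Qed.

Lemma scalar_funZ (V : lmodType F) (l : V -> F^o) a v :
  scalar l -> l (a *: v) = a * l v.
Proof. by move=> lP; rewrite -[_ *: _]addr0 lP scalar_fun0 // addr0. Qed.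

Lemma scalar_funB (V : lmodType F) (l : V -> F^o) u v :
  scalar l -> l (u - v) = l u - l v.
Proof. by move=> lP; rewrite -scaleN1r addrC lP mulN1r addrC. Qed.

Lemma scalar_fun_sum (V : lmodType F) (l : V -> F^o) (T : Type) (s : seq T)
    (a : T -> F) (f : T -> V) :
  scalar l -> l (\sum_(t <- s) a t *: f t) = \sum_(t <- s) a t * l (f t).
Proof.
move=> lP; elim: s => [|t s IHs]; last by rewrite !big_cons lP IHs.
by rewrite !big_nil scalar_fun0.
Qed.

(** Steinitz exchange in dual form.  The functionals [l] are dual to [f], while
    [l0] sees [b] and none of the [f t]; together they separate the points of
    [Z].  Subtracting [l0 c *: b] moves [c] inside its class to a vector that
    [l0] kills, and such a vector is determined by its coordinates [l t].
    The closure hypothesis on [c - l0 c *: b] does not force [b] into [Z], so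
    that a [Z] on which [l0] vanishes is covered too. *)
Lemma quotient_basis (V : lmodType F) (B : {pred V})
    (B_closed : submod_closed B) (Z : V -> Prop) (b : V) (l0 : V -> F^o)
    (T : eqType) (s : seq T) (f : T -> V) (l : T -> V -> F^o) :
  b \in B -> (forall v, v \in B -> exists a, v = a *: b) ->
  scalar l0 -> (forall t, scalar (l t)) ->
  l0 b = 1 -> (forall t, t \in s -> l0 (f t) = 0) ->
  uniq s ->
  {in s &, forall t t', l t (f t') = (t == t')%:R} ->
  (forall a u v, Z u -> Z v -> Z (a *: u + v)) ->
  (forall t, t \in s -> Z (f t)) ->
  (forall c, Z c -> Z (c - l0 c *: b)) ->
  (forall c, Z c -> l0 c = 0 -> (forall t, t \in s -> l t c = 0) -> c = 0) ->
  is_basis [set proj B_closed c | c in Z]%classic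
           [seq proj B_closed (f t) | t <- s].
Proof.
move=> bB Bb l0P lP l0b l0f s_uniq lf ZD Zf Zb Zinj.
have l_sum (a : T -> F) t :
    t \in s -> l t (\sum_(t' <- s) a t' *: f t') = a t.
  move=> ts; rewrite scalar_fun_sum // (bigD1_seq t) //= lf // eqxx mulr1.
  rewrite big_seq_cond big1 ?addr0 // => t' /andP[t's t't].
  by rewrite lf // eq_sym (negPf t't) mulr0.
have l0_sum (a : T -> F) : l0 (\sum_(t <- s) a t *: f t) = 0.
  by rewrite scalar_fun_sum // big_seq big1 // => t ts; rewrite l0f // mulr0.
have projS (a : T -> F) : \sum_(t <- s) a t *: proj B_closed (f t) =
    proj B_closed (\sum_(t <- s) a t *: f t).
  by rewrite linear_sum; apply: eq_bigr => t _; rewrite linearZ.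
apply: is_basis_map => //.
- by move=> t ts; exists (f t) => //; exact: Zf.
- move=> a; rewrite projS -(linear0 (proj B_closed)) => /proj_eq.
  rewrite subr0 => /Bb[k fk] t ts.
  have k0 : k = 0.
    by have := l0_sum a; rewrite fk scalar_funZ // l0b mulr1.
  by rewrite -(l_sum a t ts) fk k0 scale0r; exact: scalar_fun0.
move=> _ [c Zc <-]; pose c' := c - l0 c *: b.
exists (fun t => l t c'); rewrite projS; apply/proj_eq.
pose r := c' - \sum_(t <- s) l t c' *: f t.
have Zr : Z r.
  rewrite /r; have sub_s : {subset s <= s} by [].
  elim: {1 3}s sub_s => [|t r' IHr] sub_s.
    by rewrite big_nil subr0; exact: Zb.
  rewrite big_cons opprD addrCA -scaleNr; apply: ZD.
    by apply: Zf; rewrite sub_s ?mem_head.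
  by apply: IHr => u ur; apply: sub_s; rewrite inE ur orbT.
have r0 : r = 0.
  apply: Zinj => // [|t ts]; rewrite scalar_funB //.
    by rewrite l0_sum subr0 /c' scalar_funB // scalar_funZ // l0b mulr1 subrr.
  by rewrite l_sum // subrr.
have -> : c - \sum_(t <- s) l t c' *: f t = l0 c *: b.
  by rewrite -(subr0_eq r0) /c' opprB addrC subrK.
have [B0 BD] := B_closed.
by rewrite -[l0 c *: b]addr0; apply: BD.
Qed.

End BasisOfQuotient.

(** * Labels of the basic cocycles *)

Section CocycleIndices.
Variables (m n : nat) (j0 : 'I_n).

(** The squares [Y2] are separate from [YY] because the dual form of y_i /\ y_i
    is given by another formula, and because one of them is to be left out. *)
Inductive cocycle_index :=
  | XX of 'I_(m + m) & 'I_(m + m)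
  | XY of 'I_(m + m) & 'I_n
  | YY of 'I_n & 'I_n
  | Y2 of 'I_n
  | Xbar of 'I_(m + m + 1).

HB.instance Definition _ := gen_eqMixin cocycle_index.

(** Pairs that are not strictly increasing would give 0, or repeat another form up
    to sign. *)
Definition valid (t : cocycle_index) : bool :=
  match t with
  | XX i j => (i < j)%N
  | YY i j => (i < j)%N
  | _ => true
  end.

Definition is_odd (t : cocycle_index) : bool := if t is XY _ _ then true else false.

Definition XXs := [seq XX i j | i <- enum 'I_(m + m),
  j <- [seq j : 'I_(m + m) <- enum 'I_(m + m) | (i < j)%N]].
Definition XYs := [seq XY i j | i <- enum 'I_(m + m), j <- enum 'I_n].
Definition YYs := [seq YY i j | i <- enum 'I_n,
  j <- [seq j : 'I_n <- enum 'I_n | (i < j)%N]].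
Definition Y2s := [seq Y2 j | j <- [seq j <- enum 'I_n | j != j0]].
Definition Xbars := [seq Xbar i | i <- enum 'I_(m + m + 1)].

Lemma mem_XXs t : t \in XXs = if t is XX i j then (i < j)%N else false.
Proof.
apply/allpairsPdep/idP => [[i [j [_ + ->]]]|]; first by rewrite mem_filter => /andP[].
by case: t => // i j ij; exists i, j; split=> //;
  [|rewrite mem_filter ij]; exact: mem_enum.
Qed.

Lemma mem_XYs t : t \in XYs = is_odd t.
Proof.
apply/allpairsPdep/idP => [[i [j [_ _ ->]]]//|].
by case: t => // i j _; exists i, j; split; rewrite ?mem_enum.
Qed.

Lemma mem_YYs t : t \in YYs = if t is YY i j then (i < j)%N else false.
Proof.
apply/allpairsPdep/idP => [[i [j [_ + ->]]]|]; first by rewrite mem_filter => /andP[].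
by case: t => // i j ij; exists i, j; split=> //;
  [|rewrite mem_filter ij]; exact: mem_enum.
Qed.

Lemma mem_Y2s t : t \in Y2s = if t is Y2 j then j != j0 else false.
Proof.
apply/mapP/idP => [[j + ->]|]; first by rewrite mem_filter => /andP[].
by case: t => // j jj; exists j; rewrite // mem_filter jj; exact: mem_enum.
Qed.

Lemma mem_Xbars t : t \in Xbars = if t is Xbar i then true else false.
Proof.
apply/mapP/idP => [[j + ->]//|].
by case: t => // j _; exists j; rewrite // mem_enum.
Qed.

Lemma uniq_pairs k l (P : 'I_k -> pred 'I_l) (f : 'I_k -> 'I_l -> cocycle_index) :
  (forall i j i' j', f i j = f i' j' -> i = i' /\ j = j') ->
  uniq [seq f i j | i <- enum 'I_k, j <- [seq j <- enum 'I_l | P i j]].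
Proof.
move=> f_inj; apply: allpairs_uniq_dep => [|i _|]; first exact: enum_uniq.
  by rewrite filter_uniq ?enum_uniq.
by move=> [i j] [i' j'] _ _ /= /f_inj[<- <-].
Qed.

Lemma uniq_XXs : uniq XXs.
Proof. by apply: uniq_pairs => i j i' j' [-> ->]. Qed.

Lemma uniq_XYs : uniq XYs.
Proof.
by apply: allpairs_uniq; rewrite ?enum_uniq // => -[i j] [i' j'] _ _ /= [-> ->].
Qed.

Lemma uniq_YYs : uniq YYs.
Proof. by apply: uniq_pairs => i j i' j' [-> ->]. Qed.

Lemma uniq_Y2s : uniq Y2s.
Proof.
rewrite map_inj_uniq; last by move=> i j [].
by apply: filter_uniq; exact: enum_uniq.
Qed.

Lemma uniq_Xbars : uniq Xbars.
Proof. by rewrite map_inj_uniq; [exact: enum_uniq|move=> i j []]. Qed.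

Definition evens := XXs ++ YYs ++ Y2s ++ Xbars.
Definition indices := XXs ++ XYs ++ YYs ++ Y2s ++ Xbars.

Lemma Y2_eq j : (Y2 j == Y2 j0) = (j == j0).
Proof. by apply/eqP/eqP => [[]|->]. Qed.

Lemma mem_indices t : t \in indices = valid t && (t != Y2 j0).
Proof.
rewrite !mem_cat mem_XXs mem_XYs mem_YYs mem_Y2s mem_Xbars.
by case: t => [i j|i j|i j|j|i]; rewrite ?orbF ?orbT /= ?Y2_eq //;
  rewrite (_ : (_ != _) = true) ?andbT //; apply/eqP.
Qed.

Lemma uniq_indices : uniq indices.
Proof.
rewrite !cat_uniq uniq_XXs uniq_XYs uniq_YYs uniq_Y2s uniq_Xbars /= !andbT.
apply/and4P; split; apply/hasPn => t;
  rewrite ?mem_cat ?mem_XXs ?mem_XYs ?mem_YYs ?mem_Y2s ?mem_Xbars;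
  by case: t.
Qed.

Lemma mem_evens t : t \in evens = [&& valid t, t != Y2 j0 & ~~ is_odd t].
Proof.
rewrite !mem_cat mem_XXs mem_YYs mem_Y2s mem_Xbars.
by case: t => [i j|i j|i j|j|i]; rewrite ?orbF ?orbT /= ?Y2_eq ?andbT ?andbF //;
  rewrite (_ : (_ != _) = true) ?andbT //; apply/eqP.
Qed.

Lemma uniq_evens : uniq evens.
Proof.
have := uniq_indices; rewrite /indices -/evens.
rewrite uniq_catCA cat_uniq => /and3P[_ _ //].
Qed.

(** There are j pairs with larger entry j, which gives the
    triangular sum directly. *)
Lemma size_pairs k (T : Type) (f : 'I_k -> 'I_k -> T) :
  size [seq f i j | i <- enum 'I_k, j <- [seq j : 'I_k <- enum 'I_k | (i < j)%N]]
  = 'C(k, 2).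
Proof.
rewrite size_allpairs_dep sumnE big_map big_enum /= -bin2_sum big_mkord.
transitivity (\sum_(i < k) \sum_(j < k | (i < j)%N) 1)%N.
  by apply: eq_bigr => i _; rewrite -sum1_size big_filter big_enum_cond.
rewrite (exchange_big_dep xpredT) //=; apply: eq_bigr => j _.
by rewrite -(big_ord_widen k (fun=> 1%N)) ?sum1_card ?card_ord // ltnW.
Qed.

Lemma size_Y2s : size Y2s = n.-1.
Proof.
rewrite size_map -(rem_filter j0 (enum_uniq _)) size_rem; last exact: mem_enum.
by rewrite size_enum_ord.
Qed.

Lemma size_evens : size evens = (2 * m ^ 2 + m + (n ^ 2 + n) %/ 2)%N.
Proof.
have size_Xbars : size Xbars = (m + m + 1)%N by rewrite size_map size_enum_ord.
rewrite !size_cat !size_pairs size_Y2s size_Xbars.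
have bin2_mul2 k : ('C(k, 2) * 2 = k * k.-1)%N.
  by rewrite (bin_ffact k 2) ffactnS ffactn1.
have n_gt0 : (0 < n)%N by exact: leq_ltn_trans (leq0n j0) (ltn_ord j0).
(* Pairs and squares of the odd coordinates together, before the exchange. *)
have -> : (n ^ 2 + n = ('C(n, 2) + n) * 2)%N.
  by rewrite mulnDl bin2_mul2; case: (n) n_gt0 => // k _ /=; lia.
rewrite mulnK //; have := bin2_mul2 (m + m)%N.
by have [->|m_gt0] := posnP m; rewrite ?bin0n; lia.
Qed.

Lemma size_XYs : size XYs = (2 * m * n)%N.
Proof. by rewrite size_allpairs !size_enum_ord addnn mul2n. Qed.

End CocycleIndices.

Arguments XX {m n}.
Arguments XY {m n}.
Arguments YY {m n}.
Arguments Y2 {m n}.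
Arguments Xbar {m n}.

(** * Restricted 2-cocycles of the Heisenberg superalgebra *)

Section Precochains.
Variables (F : fieldType) (p : nat) (L : restrictedLieSuperalgebra F p).

Lemma eval_form a (c c' : precochain2 L) u v :
  (a *: c + c').1 u v = a * c.1 u v + c'.1 u v.
Proof. by rewrite [LHS]/= !addrfctE !scalrfctE. Qed.

Lemma eval_omega a (c c' : precochain2 L) g :
  (a *: c + c').2 g = a * c.2 g + c'.2 g.
Proof. by rewrite [LHS]/= addrfctE scalrfctE. Qed.

End Precochains.

Section HeisenbergCocycles.
Variables (F : fieldType) (p : nat) (p_gt2 : (2 < p)%N).
Hypothesis charFp : p \in [pchar F].
Variables (m n : nat) (i0 : 'I_m) (j0 : 'I_n) (lam : 'rV[F]_(m + m + 1)).

Local Notation h := (heisenberg n lam p_gt2 charFp).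
Local Notation H := ('rV[F]_(m + m + 1) * 'rV[F]_n)%type.
Local Notation zi := (zidx m).
Local Notation ex i := ((x_ F i, 0) : H).
Local Notation ey j := ((0, y_ F j) : H).
Local Notation z := (ex zi).

Lemma two_neq0 : 2%:R != 0 :> F.
Proof.
apply/negP => /eqP F2; have := dvdn_pcharf charFp 2.
by rewrite F2 eqxx => /dvdn_leq => /(_ isT); rewrite leqNgt p_gt2.
Qed.

Lemma eq_opp_0 (a : F) : a = - a -> a = 0.
Proof.
move=> aN; apply/eqP; have /eqP : 2%:R * a = 0.
  by rewrite mulr_natl mulr2n {2}aN subrr.
by rewrite mulf_eq0 (negPf two_neq0).
Qed.

(** A linear form is determined by its values on the basis of [h]. *)
Lemma scalar_eq0 (g : H -> F^o) : scalar g ->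
  (forall i, g (ex i) = 0) -> (forall j, g (ey j) = 0) -> forall u, g u = 0.
Proof.
move=> gP gx gy [u0 u1].
have -> : (u0, u1) = \sum_i u0 0 i *: ex i + \sum_j u1 0 j *: ey j.
  have -> : \sum_i u0 0 i *: ex i = (u0, 0).
    rewrite {2}[u0]row_sum_delta; elim/big_rec2: _ => // i a b _ ->.
    by congr pair; rewrite /= scaler0 addr0.
  have -> : \sum_j u1 0 j *: ey j = (0, u1).
    rewrite {2}[u1]row_sum_delta; elim/big_rec2: _ => // i a b _ ->.
    by congr pair; rewrite /= scaler0 addr0.
  by congr pair; rewrite /= ?addr0 ?add0r.
rewrite -[X in X + _]scale1r gP mul1r !scalar_fun_sum //.
by rewrite !big1 ?addr0 // => i _; rewrite ?gx ?gy mulr0.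
Qed.

Lemma C2_central phi v : C2 (L := h) phi -> (forall v, phi z v = 0) -> phi v z = 0.
Proof.
move=> [phil _ phiC] zphi; move: v; apply: (scalar_eq0 (phil z)) => k.
  by rewrite (phiC false false) //= zphi mulr0 oppr0.
by rewrite (phiC true false) //= zphi mulr0 oppr0.
Qed.

Lemma bracketE (u v : h) : bracket u v = heis_form u v *: (z : h).
Proof. by congr pair; rewrite /= scaler0. Qed.

Lemma C2_bracket phi (u v w : h) :
  C2 (L := h) phi -> phi (bracket u v) w = heis_form u v * phi z w.
Proof. by move=> [phil _ _]; rewrite bracketE (scalar_funZ _ _ (phil w)). Qed.

Lemma heis_form0l (v : H) : heis_form 0 v = 0.
Proof. exact: (scalar_fun0 (heis_form_linearl v)). Qed.

Lemma heis_form0r (u : H) : heis_form u 0 = 0.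
Proof. exact: (scalar_fun0 (heis_form_linearr u)). Qed.

(** Only one of the eight terms of [d2] survives: the other components of the
    homogeneous arguments are 0. *)
Lemma d2_of_homogeneous phi a b c (u v w : h) : C2 (L := h) phi ->
  homogeneous a u -> homogeneous b v -> homogeneous c w ->
  d2 phi u v w = d2_homogeneous phi a b c u v w.
Proof.
move=> phiC hu hv hw.
have compK e (t : H) : homogeneous e t -> component e t = t.
  by case: e t => -[t0 t1] /= ->.
have comp0 e e' (t : H) : homogeneous e t -> e' != e -> component e' t = 0.
  by case: e e' t => -[] [t0 t1] //= ->.
have phi0 : phi z 0 = 0 by have [_ phir _] := phiC; exact: scalar_fun0 (phir z).
have Eu a' b' c' v' w' : d2_homogeneous phi a' b' c' 0 v' w' = 0.
  by rewrite /d2_homogeneous !C2_bracket // !heis_form0l phi0; ring.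
have Ev a' b' c' u' w' : d2_homogeneous phi a' b' c' u' 0 w' = 0.
  by rewrite /d2_homogeneous !C2_bracket // !(heis_form0l, heis_form0r) phi0; ring.
have Ew a' b' c' u' v' : d2_homogeneous phi a' b' c' u' v' 0 = 0.
  by rewrite /d2_homogeneous !C2_bracket // !heis_form0r phi0; ring.
rewrite /d2 (bigD1 a) //= [X in _ + X]big1 => [|a' a'a]; last first.
  by rewrite big1 // => b' _; rewrite big1 // => c' _; rewrite (comp0 _ _ _ hu a'a) Eu.
rewrite (bigD1 b) //= [X in _ + X + _]big1 => [|b' b'b]; last first.
  by rewrite big1 // => c' _; rewrite (comp0 _ _ _ hv b'b) Ev.
rewrite (bigD1 c) //= [X in _ + X + _ + _]big1 => [|c' c'c]; last first.
  by rewrite (comp0 _ _ _ hw c'c) Ew.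
by rewrite !addr0 !compK.
Qed.

Lemma heis_form_yy j : heis_form (ey j) (ey j) = 1.
Proof.
have /(congr1 (fun u : H => u.1 0 zi)) := heis_bracket_basis_yy F m j j.
by rewrite /= !mxE !eqxx !mulr1.
Qed.

Lemma heis_form_xx i :
  heis_form (ex (xidx (lshift m i))) (ex (xidx (rshift m i))) = 1.
Proof.
have /(congr1 (fun u : H => u.1 0 zi)) :=
  heis_bracket_basis_xx F n (xidx (lshift m i)) (xidx (rshift m i)).
rewrite /= !mxE !eqxx !mulr1 /= ltn_ord => ->.
by rewrite [(m + i < m)%N]ltnNge leq_addr subr0.
Qed.

(** A closed form kills the center: an odd basis vector is tested against
    x_i, x_(m+i), whose bracket is z and which commute with it; an even one
    against y, y for the same reason. *)
Lemma d2_eq0 phi : C2 (L := h) phi ->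
  (forall u v w, d2 (L := h) phi u v w = 0) <-> (forall v, phi z v = 0).
Proof.
move=> phiC; split=> [d2phi|zphi u v w]; last first.
  rewrite /d2 big1 // => a _; rewrite big1 // => b _; rewrite big1 // => c _.
  by rewrite /d2_homogeneous !C2_bracket // !zphi; ring.
have [_ phir _] := phiC.
apply: (scalar_eq0 (phir z)) => k.
  have := d2phi (ey j0) (ey j0) (ex k).
  rewrite (@d2_of_homogeneous _ true true false) // /d2_homogeneous !C2_bracket //.
  have yx0 : heis_form (ey j0) (ex k) = 0.
    by rewrite (@heis_form_skew _ _ _ true false) // heis_form_even // mulr0 oppr0.
  by rewrite heis_form_yy yx0 mul1r !mul0r !mulr0 subr0 addr0.
have := d2phi (ex (xidx (lshift m i0))) (ex (xidx (rshift m i0))) (ey k).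
rewrite (@d2_of_homogeneous _ false false true) // /d2_homogeneous !C2_bracket //.
have xy0 i : heis_form (ex i) (ey k) = 0 by rewrite heis_form_even.
by rewrite heis_form_xx !xy0 mul1r !mul0r !mulr0 subr0 addr0.
Qed.

Definition semilinear_cochain (omega : even_part h -> F^o) : Prop :=
  (forall a g, omega (a *: g) = a ^+ p * omega g) /\
  (forall g g', omega (g + g') = omega g + omega g').

(** Each word has at least three letters, so the first argument of [phi] in the
    word sum is a bracket, that is, a multiple of z. *)
Lemma compatibleE phi omega : C2 (L := h) phi -> (forall v, phi z v = 0) ->
  compatible (L := h) phi omega <-> semilinear_cochain omega.
Proof.
move=> phiC zphi.
have word0 g g' : word_sum p g g' (fun s : seq h =>
    phi (lnbr (take p.-1 s)) (nth 0 s p.-1)) = 0.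
  rewrite /word_sum big1 // => c _; set s := map _ _.
  have size_s : size (take p.-1 s) = p.-1.
    by rewrite size_takel // size_map size_tuple leq_pred.
  rewrite (lnbr_last size_s) ?C2_bracket ?zphi ?mulr0 ?scaler0 //.
  by case: (p) p_gt2 => [|[|[]]].
by split=> -[omZ omD]; split=> // g g'; rewrite omD word0 addr0.
Qed.

(** The p-map has central values and brackets of length three vanish. *)
Lemma ind2_eq0 phi g k : C2 (L := h) phi -> (forall v, phi z v = 0) ->
  ind2 (L := h) phi g k = 0.
Proof.
move=> phiC zphi; have [phil phir _] := phiC.
rewrite /ind2.
have -> : ev (L := h) (Defs.pmap k) = (\sum_i k 0 i ^+ p * lam 0 i) *: (z : h).
  by congr pair; rewrite /= scaler0.
rewrite (scalar_funZ _ _ (phir g)) (C2_central _ phiC zphi) mulr0 sub0r.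
rewrite heis_lnbr0; last by rewrite /= size_nseq; case: (p) p_gt2 => [|[|[]]].
by rewrite (scalar_fun0 (phil _)) oppr0.
Qed.

Lemma Z2resE (c : precochain2 h) : Z2res c <->
  [/\ C2 (L := h) c.1, forall v, c.1 z v = 0 & semilinear_cochain c.2].
Proof.
split=> [[[cC comp] d2c _]|[cC zc semi]].
  by have zc := (d2_eq0 cC).1 d2c; split=> //; apply/(compatibleE _ cC zc).
split=> [|u v w|g k]; first by split=> //; apply/(compatibleE _ cC zc).
- exact: (d2_eq0 cC).2.
- exact: ind2_eq0.
Qed.

Lemma xbasis_span : (<<xbasis n lam p_gt2 charFp>> = fullv)%VS.
Proof.
apply/eqP; rewrite eqEsubv subvf /=; apply/subvP => g _.
rewrite [g]row_sum_delta; apply: rpred_sum => i _; apply: rpredZ.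
by apply: memv_span; apply/mapP; exists i; rewrite ?mem_enum.
Qed.

(** The zero map is compatible with a form that kills the center, and it
    vanishes on the basis, so uniqueness identifies it with the chosen one. *)
Lemma with_tildeE phi : C2 (L := h) phi -> (forall v, phi z v = 0) ->
  with_tilde (xbasis n lam p_gt2 charFp) phi = (phi, 0).
Proof.
move=> phiC zphi.
have comp0 : compatible (L := h) phi 0.
  by apply/(compatibleE _ phiC zphi); split=> [a g|g g']; rewrite ?mulr0 ?addr0.
congr pair; apply: xget_unique => // omega [comp om0].
apply: (compatible_unique (L := h) _ xbasis_span comp comp0).
  by case: (p) p_gt2.
by move=> g gb; rewrite om0.
Qed.

(** * A dual family of cocycles and coordinates *)

Definition cocycle (t : cocycle_index m n) : precochain2 h :=
  match t with
  | XX i j => (@dual_xx F m n (xidx i) (xidx j), 0)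
  | XY i j => (@dual_xy F m n (xidx i) j, 0)
  | YY i j => (@dual_yy F m n i j, 0)
  | Y2 j => (@dual_yy F m n j j, 0)
  | Xbar i => (0, xbar p i)
  end.

Definition coef (t : cocycle_index m n) (c : precochain2 h) : F^o :=
  match t with
  | XX i j => c.1 (ex (xidx i)) (ex (xidx j))
  | XY i j => c.1 (ex (xidx i)) (ey j)
  | YY i j => c.1 (ey i) (ey j)
  | Y2 j => c.1 (ey j) (ey j)
  | Xbar i => c.2 (x_ F i)
  end.

Lemma coef_scalar t : scalar (coef t).
Proof.
by case: t => [i j|i j|i j|j|i] a u v; rewrite /coef;
  [exact: eval_form..|exact: eval_omega].
Qed.

Lemma xc_y i k : xc i (ey k) = 0.
Proof. exact: xc_odd. Qed.

Lemma yc_x j k : yc j (ex k) = 0.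
Proof. exact: yc_even. Qed.

Lemma xidx_eq (i k : 'I_(m + m)) : (xidx i == xidx k) = (i == k).
Proof. exact: eq_lshift. Qed.

Lemma coef_cocycle t : valid t -> coef t (cocycle t) = 1.
Proof.
case: t => [i j|i j|i j|j|i] ij; rewrite /coef /cocycle [LHS]/=.
- rewrite /dual_xx !xc_x !xidx_eq !eqxx (gtn_eqF ij : (j == i) = false).
  by rewrite mulr0 subr0 mulr1.
- by rewrite /dual_xy xc_x yc_y yc_x !eqxx mulr1 mul0r subr0.
- have ij0 : (i == j) = false by exact: ltn_eqF.
  by rewrite /dual_yy ij0 !yc_y !eqxx ij0 mul0r addr0 mulr1.
- by rewrite /dual_yy eqxx !yc_y eqxx mulr1.
- by rewrite /xbar /x_ mxE !eqxx expr1n.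
Qed.

Lemma delta_mul0 (T U : eqType) (i j : T) (k l : U) :
  (i = j -> k = l -> False) -> (i == j)%:R * (k == l)%:R = 0 :> F.
Proof.
by case: eqVneq => [->|_]; case: eqVneq => [->|_] E;
  rewrite ?mulr0 ?mul0r //; case: E.
Qed.

Lemma coef_cocycle_neq t t' : valid t -> valid t' -> t <> t' ->
  coef t (cocycle t') = 0.
Proof.
case: t => [i j|i j|i j|j|i]; case: t' => [k l|k l|k l|l|k] // ij kl neq;
  rewrite /coef /cocycle [LHS]/= ?/dual_xx ?/dual_xy ?/dual_yy ?eqxx;
  try (case: ifP => [/eqP kl'|_]; first by move: kl; rewrite kl' /= ltnn);
  rewrite ?xc_x ?yc_y ?xc_y ?yc_x ?xidx_eq;
  rewrite ?mulr0 ?mul0r ?subr0 ?addr0; try reflexivity.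
- rewrite !delta_mul0 ?subr0 // => [il jk|ik jl]; last by apply: neq; rewrite ik jl.
  by move: ij kl; rewrite /= il jk => /ltnW; rewrite leqNgt => /negP.
- by rewrite delta_mul0 // => ik jl; apply: neq; rewrite ik jl.
- rewrite !delta_mul0 ?addr0 // => [il jk|ik jl]; last by apply: neq; rewrite ik jl.
  by move: ij kl; rewrite /= il jk => /ltnW; rewrite leqNgt => /negP.
- by rewrite delta_mul0 // => il jl; move: ij; rewrite /= il jl ltnn.
- by rewrite !delta_mul0 ?addr0 // => jk jl; move: kl; rewrite /= -jk -jl ltnn.
- by rewrite delta_mul0 // => jl _; apply: neq; rewrite jl.
rewrite /xbar /x_ mxE eqxx (_ : (k == i) = false) ?expr0n ?gtn_eqF //.
  by rewrite (ltn_trans _ p_gt2).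
by apply/eqP => ki; apply: neq; rewrite ki.
Qed.

(** Parity as a scalar factor: [ring] can then decide the sign rule of the dual
    forms once the parities are replaced by constants. *)
Lemma xc_parity a i (u : H) : homogeneous a u -> xc i u = (~~ a)%:R * xc i u.
Proof. by case: a => hu; rewrite ?mul1r // mul0r xc_odd. Qed.

Lemma yc_parity a j (u : H) : homogeneous a u -> yc j u = a%:R * yc j u.
Proof. by case: a => hu; rewrite ?mul1r // mul0r yc_even. Qed.

Lemma C2_dual_xx i j : C2 (L := h) (@dual_xx F m n i j).
Proof.
split=> [v a u u'|u a v v'|a b u v hu hv]; rewrite /dual_xx.
- by rewrite !xcD; rewrite /GRing.scale /=; ring.
- by rewrite !xcD; rewrite /GRing.scale /=; ring.
rewrite (xc_parity i hu) (xc_parity j hu) (xc_parity i hv) (xc_parity j hv).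
by case: a b {hu hv} => [] []; rewrite /= ?expr1 ?expr0; ring.
Qed.

Lemma C2_dual_xy i j : C2 (L := h) (@dual_xy F m n i j).
Proof.
split=> [v a u u'|u a v v'|a b u v hu hv]; rewrite /dual_xy.
- by rewrite !xcD !ycD; rewrite /GRing.scale /=; ring.
- by rewrite !xcD !ycD; rewrite /GRing.scale /=; ring.
rewrite (xc_parity i hu) (yc_parity j hu) (xc_parity i hv) (yc_parity j hv).
by case: a b {hu hv} => [] []; rewrite /= ?expr1 ?expr0; ring.
Qed.

Lemma C2_dual_yy i j : C2 (L := h) (@dual_yy F m n i j).
Proof.
split=> [v a u u'|u a v v'|a b u v hu hv]; rewrite /dual_yy; case: ifP => _.
- by rewrite !ycD; rewrite /GRing.scale /=; ring.
- by rewrite !ycD; rewrite /GRing.scale /=; ring.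
- by rewrite !ycD; rewrite /GRing.scale /=; ring.
- by rewrite !ycD; rewrite /GRing.scale /=; ring.
- rewrite (yc_parity i hu) (yc_parity i hv).
  by case: a b {hu hv} => [] []; rewrite /= ?expr1 ?expr0; ring.
rewrite (yc_parity i hu) (yc_parity j hu) (yc_parity i hv) (yc_parity j hv).
by case: a b {hu hv} => [] []; rewrite /= ?expr1 ?expr0; ring.
Qed.

Lemma C2_0 : C2 (L := h) 0.
Proof.
split=> [v a u u'|u a v v'|a b u v _ _]; apply/esym.
- by apply: etrans (addr0 _) _; exact: mulr0.
- by apply: etrans (addr0 _) _; exact: mulr0.
- by apply: etrans (oppr0 _); congr (- _); exact: mulr0.
Qed.

Lemma xidx_z i : (zi == xidx i) = false.
Proof. exact: eq_rlshift. Qed.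

Lemma cocycle_Z2res t : Z2res (cocycle t).
Proof.
have semi0 : semilinear_cochain 0 by split=> * /=; rewrite ?mulr0 ?addr0.
apply/Z2resE; case: t => [i j|i j|i j|j|i]; rewrite /cocycle; split=> //.
- exact: C2_dual_xx.
- by move=> v; rewrite /= /dual_xx !xc_x !xidx_z !mul0r subr0.
- exact: C2_dual_xy.
- by move=> v; rewrite /= /dual_xy xc_x yc_x xidx_z !mul0r subr0.
- exact: C2_dual_yy.
- by move=> v; rewrite /= /dual_yy !yc_x !mul0r addr0; case: ifP.
- exact: C2_dual_yy.
- by move=> v; rewrite /= /dual_yy eqxx yc_x mul0r.
- exact: C2_0.
split=> [a g|g g']; rewrite /= /xbar mxE ?exprMn //.
by rewrite -!(pFrobenius_autE charFp) rmorphD.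
Qed.

Lemma cocycle_part t : C2res_part (is_odd t) (cocycle t).
Proof.
split; first by case: (cocycle_Z2res t).
  case: t => [i j|i j|i j|j|i] a b u v hu hv ab //=.
  - rewrite /dual_xx (xc_parity (xidx i) hu) (xc_parity (xidx j) hu)
      (xc_parity (xidx i) hv) (xc_parity (xidx j) hv).
    by case: a b ab {hu hv} => [] [] //= _; ring.
  - rewrite /dual_xy (xc_parity (xidx i) hu) (yc_parity j hu)
      (xc_parity (xidx i) hv) (yc_parity j hv).
    by case: a b ab {hu hv} => [] [] //= _; ring.
  - rewrite /dual_yy (yc_parity i hu) (yc_parity j hu) (yc_parity i hv) (yc_parity j hv).
    by case: a b ab {hu hv} => [] [] //= _; case: ifP => _; ring.
  rewrite /dual_yy eqxx (yc_parity j hu) (yc_parity j hv).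
  by case: a b ab {hu hv} => [] [] //= _; ring.
by case: t.
Qed.

Lemma ord_split (i : 'I_(m + m + 1)) : i = zi \/ exists k, i = xidx k.
Proof.
case: (split_ordP i) => [k ->|k ->]; last by left; rewrite (ord1 k).
by right; exists k.
Qed.

(** A form that kills z is determined by its values on the other basis vectors,
    and super-antisymmetry leaves only the ordered pairs; the diagonal values
    at even vectors vanish because 2 is invertible. *)
Lemma coef_inj c : Z2res c -> (forall t, valid t -> coef t c = 0) -> c = 0.
Proof.
case: c => phi om /Z2resE[/= phiC zphi [omZ omD]] c0.
have [phil phir phiA] := phiC.
have phiz v : phi v z = 0 by exact: C2_central.
congr pair; last first.
  apply/funext => g; rewrite [g]row_sum_delta.
  elim/big_rec: _ => [|i g' _ IH].
    by have := omZ 0 0; rewrite scale0r expr0n gtn_eqF ?mul0r // (ltn_trans _ p_gt2).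
  by rewrite omD omZ IH (c0 (Xbar i) isT : om (x_ F i) = 0) mulr0 addr0.
have xy i j : phi (ex i) (ey j) = 0.
  by case: (ord_split i) => [->|[k ->]]; [exact: zphi|exact: (c0 (XY k j))].
have xx i j : phi (ex i) (ex j) = 0.
  case: (ord_split i) => [->|[k ->]]; first exact: zphi.
  case: (ord_split j) => [->|[l ->]]; first exact: phiz.
  have skew : phi (ex (xidx k)) (ex (xidx l)) = - phi (ex (xidx l)) (ex (xidx k)).
    by rewrite (phiA false false) //= expr0 mul1r.
  case: (ltngtP k l) => [kl|lk|/val_inj kl]; first exact: (c0 (XX k l)).
    by rewrite skew (c0 (XX l k) lk : phi _ _ = 0) oppr0.
  by apply: eq_opp_0; rewrite {1}skew kl.
have yy i j : phi (ey i) (ey j) = 0.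
  case: (ltngtP i j) => [ij|ji|/val_inj ->]; first exact: (c0 (YY i j)).
    rewrite (phiA true true) //= (c0 (YY j i) ji : phi _ _ = 0).
    by rewrite mulr0 oppr0.
  exact: (c0 (Y2 j)).
apply/funext => u; apply/funext => v; apply: (scalar_eq0 (phir u)) => k.
  apply: (scalar_eq0 (phil _)) => i //.
  by rewrite (phiA true false) //= xy mulr0 oppr0.
by apply: (scalar_eq0 (phil _)) => i.
Qed.

Lemma Z2res_closed a c c' : Z2res c -> Z2res c' -> Z2res (L := h) (a *: c + c').
Proof.
move=> /Z2resE[[l r s] zc [oZ oD]] /Z2resE[[l' r' s'] zc' [oZ' oD']].
apply/Z2resE; split; first split.
- by move=> v k u u'; rewrite !eval_form l l' /GRing.scale /=; ring.
- by move=> u k v v'; rewrite !eval_form r r' /GRing.scale /=; ring.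
- by move=> e e' u v hu hv; rewrite !eval_form (s e e') // (s' e e') //; ring.
- by move=> v; rewrite eval_form zc zc' mulr0 addr0.
by split=> [k g|g g']; rewrite !eval_omega ?oZ ?oZ' ?oD ?oD'; ring.
Qed.

(** * The coboundaries and the bases of the cohomology *)

(** The differential of the linear form dual to z. *)
Definition heis_cobord : precochain2 h :=
  (@heis_form F m n,
   fun g : 'rV[F]_(m + m + 1) => \sum_i g 0 i ^+ p * lam 0 i).

Lemma d1res_heis (psi : 'Hom(h, F^o)) : d1res psi = psi z *: heis_cobord.
Proof.
congr pair; last first.
  apply/funext => g; rewrite [RHS]/= scalrfctE /ind1.
  have -> : ev (L := h) (Defs.pmap g) = (\sum_i g 0 i ^+ p * lam 0 i) *: (z : h).
    by congr pair; rewrite /= scaler0.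
  by rewrite linearZ /= /GRing.scale /= mulrC.
apply/funext => u; apply/funext => v; rewrite [RHS]/= !scalrfctE /d1.
by rewrite bracketE linearZ /= /GRing.scale /= mulrC.
Qed.

Lemma heis_cobord_B2res : heis_cobord \in @B2res F p h.
Proof.
have xcP : scalar (@xc F m n zi) by move=> a u v; rewrite xcD.
pose f : {linear h -> F^o} := HB.pack (@xc F m n zi : h -> F^o)
  (GRing.isLinear.Build F h F^o *%R (@xc F m n zi) xcP).
apply/asboolP; exists (linfun f).
by rewrite d1res_heis lfunE /= xc_x eqxx scale1r.
Qed.


(** [Z] stands for all the cocycles or for those of one parity; the last
    hypothesis says that the labels outside [s] do not see [Z]. *)
Lemma class_basis (Z : precochain2 h -> Prop) (s : seq (cocycle_index m n)) :
  uniq s -> (forall t, t \in s -> valid t && (t != Y2 j0)) ->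
  (forall c, Z c -> Z2res c) ->
  (forall a c c', Z c -> Z c' -> Z (a *: c + c')) ->
  (forall t, t \in s -> Z (cocycle t)) ->
  (forall c, Z c -> Z (c - coef (Y2 j0) c *: heis_cobord)) ->
  (forall c t, Z c -> valid t -> t != Y2 j0 -> t \notin s -> coef t c = 0) ->
  is_basis [set cls c | c in Z]%classic [seq cls (cocycle t) | t <- s].
Proof.
move=> s_uniq s_valid ZZ2 ZD Zs Zb Zcoef.
apply: (@quotient_basis _ _ _ (B2res_submod_closed h) Z heis_cobord
  (coef (Y2 j0)) (cocycle_index m n) s cocycle coef).
- exact: heis_cobord_B2res.
- by move=> v /asboolP[psi ->]; exists (psi z); exact: d1res_heis.
- exact: coef_scalar.
- by move=> t; exact: coef_scalar.
- by rewrite /coef /heis_cobord; exact: heis_form_yy.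
- move=> t /s_valid/andP[tv tj]; apply: coef_cocycle_neq => //.
  by apply/eqP; rewrite eq_sym.
- exact: s_uniq.
- move=> t t' ts t's; case: (eqVneq t t') => [<-|/eqP neq].
    by apply: coef_cocycle; case/andP: (s_valid _ ts).
  have [/andP[tv _] /andP[t'v _]] := (s_valid _ ts, s_valid _ t's).
  exact: coef_cocycle_neq.
- exact: ZD.
- exact: Zs.
- exact: Zb.
move=> c Zc c0 cs; apply: coef_inj; first exact: ZZ2.
move=> t tv; have [->//|tj] := eqVneq t (Y2 j0).
by have [/cs//|ts] := boolP (t \in s); exact: Zcoef.
Qed.

Lemma coef_part e c t : C2res_part (L := h) e c -> is_odd t != e -> coef t c = 0.
Proof.
case=> _ par c2; case: t => [i j|i j|i j|j|i]; case: e par c2 => // par c2 _.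
- exact: (par false false).
- exact: (par false true).
- exact: (par true true).
- exact: (par true true).
by rewrite /coef c2.
Qed.

Lemma part_closed e a c c' : Z2res (L := h) (a *: c + c') ->
  C2res_part e c -> C2res_part e c' -> C2res_part (L := h) e (a *: c + c').
Proof.
move=> [cC _ _] [_ par c2] [_ par' c2']; split=> //.
  move=> b b' u v hu hv bb'.
  by rewrite eval_form (par b b') // (par' b b') // mulr0 addr0.
move=> et; apply/funext => g.
by rewrite eval_omega c2 // c2' // mulr0 addr0.
Qed.

Lemma heis_cobord_Z2res : Z2res heis_cobord.
Proof.
by have /asboolP[psi ->] := heis_cobord_B2res; exact: d1res_Z2res.
Qed.

Lemma heis_cobord_part : C2res_part false heis_cobord.
Proof.
split=> //; first by case: heis_cobord_Z2res.
move=> [] [] u v hu hv //= _; last exact: heis_form_even.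
by rewrite (heis_form_skew hu hv) heis_form_even // mulr0 oppr0.
Qed.

(** In odd parity the exchange step is void: the coordinate at [Y2 j0] of an
    odd form is 0, so no multiple of [heis_cobord] is subtracted. *)
Lemma part_basis e (s : seq (cocycle_index m n)) : uniq s ->
  (forall t, t \in s = [&& valid t, t != Y2 j0 & is_odd t == e]) ->
  is_basis (H2res_part h e) [seq cls (cocycle t) | t <- s].
Proof.
move=> s_uniq s_mem.
apply: (@class_basis (fun c => Z2res c /\ C2res_part e c) s s_uniq).
- by move=> t; rewrite s_mem => /and3P[-> ->].
- by move=> c [].
- move=> a c c' [cZ ce] [cZ' ce']; have Z := Z2res_closed a cZ cZ'.
  by split=> //; exact: part_closed.
- move=> t; rewrite s_mem => /and3P[_ _ /eqP <-].
  by split; [exact: cocycle_Z2res|exact: cocycle_part].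
- case: e {s_mem} => c [cZ ce].
    by rewrite (coef_part ce) // scale0r subr0.
  rewrite addrC -scaleNr; have Z := Z2res_closed (- coef (Y2 j0) c) heis_cobord_Z2res cZ.
  by split=> //; apply: part_closed => //; exact: heis_cobord_part.
move=> c t [_ ce] tv tj; rewrite s_mem tv tj /= => te.
exact: coef_part ce te.
Qed.

Lemma H2res_basis : is_basis (H2res h) [seq cls (cocycle t) | t <- indices m j0].
Proof.
apply: class_basis => //.
- exact: uniq_indices.
- by move=> t; rewrite mem_indices.
- exact: Z2res_closed.
- by move=> t _; exact: cocycle_Z2res.
- move=> c cZ; rewrite addrC -scaleNr; apply: Z2res_closed => //.
  exact: heis_cobord_Z2res.
by move=> c t _ tv tj; rewrite mem_indices tv tj.
Qed.

End HeisenbergCocycles.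

Theorem theorem3p2 (F : closedFieldType) (p : nat) (p_gt2 : (2 < p)%N)
    (charFp : p \in [pchar F]) (m n : nat) (m_gt0 : (0 < m)%N)
    (n_gt0 : (0 < n)%N) (lam : 'rV[F]_(m + m + 1)) :
  let h := heisenberg n lam p_gt2 charFp in
  let t (phi : h -> h -> F^o) : precochain2 h :=
    with_tilde (xbasis n lam p_gt2 charFp) phi in
  let cocycles : seq (precochain2 h) :=
    [seq t (@dual_xx F m n (xidx i) (xidx j))
       | i <- enum 'I_(m + m), j <- [seq j : 'I_(m + m) <- enum 'I_(m + m) | (i < j)%N]]
    ++ [seq t (@dual_xy F m n (xidx i) j)
       | i <- enum 'I_(m + m), j <- enum 'I_n]
    ++ [seq t (@dual_yy F m n i j)
       | i <- enum 'I_n, j <- [seq j : 'I_n <- enum 'I_n | (i < j)%N]]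
    ++ [seq t (@dual_yy F m n i i) | i <- [seq i : 'I_n <- enum 'I_n | (i < n.-1)%N]]
    ++ [seq ((0, xbar p i) : precochain2 h) | i <- enum 'I_(m + m + 1)] in
  [/\ sdim_H2res h
        (2 * m ^ 2 + m + (n ^ 2 + n) %/ 2, 2 * m * n)%N,
      forall c, c \in cocycles -> Z2res c &
      is_basis (H2res h) [seq cls c | c <- cocycles]].
Proof.
move=> h t cocycles.
pose i0 : 'I_m := Ordinal m_gt0.
(* The last odd coordinate is the one whose square is left out. *)
have lt_n : (n.-1 < n)%N by rewrite prednK.
pose j0 : 'I_n := Ordinal lt_n.
pose f := @cocycle F p p_gt2 charFp m n lam.
have tE k : (if k is Xbar _ then True else t (f k).1 = f k).
  have /(Z2resE i0 j0)[kC kz _] := cocycle_Z2res p_gt2 charFp i0 j0 lam k.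
  by case: k kC kz => // *; exact: with_tildeE.
have cocyclesE : cocycles = [seq f k | k <- indices m j0].
  rewrite /indices !map_cat !map_allpairs; 
    congr cat; last congr cat; last congr cat; last congr cat.
  - by apply: eq_allpairs => i j; exact: (tE (XX i j)).
  - by apply: eq_allpairs => i j; exact: (tE (XY i j)).
  - by apply: eq_allpairs => i j; exact: (tE (YY i j)).
  - have -> : [seq i : 'I_n <- enum 'I_n | (i < n.-1)%N] = [seq j <- enum 'I_n | j != j0].
      apply: eq_filter => j; rewrite -val_eqE /= ltn_neqAle.
      by rewrite -ltnS prednK // ltn_ord andbT.
    by rewrite -map_comp; apply: eq_map => j; exact: (tE (Y2 j)).
  by rewrite -[RHS]map_comp.
split.
- split.
    exists [seq cls (f k) | k <- evens m j0]; last by rewrite size_map size_evens.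
    apply: (@part_basis _ _ p_gt2 charFp _ _ i0 j0 lam) => //; first exact: uniq_evens.
    by move=> k; rewrite mem_evens eqbF_neg.
  exists [seq cls (f k) | k <- XYs m n]; last by rewrite size_map size_XYs.
  apply: (@part_basis _ _ p_gt2 charFp _ _ i0 j0 lam) => //; first exact: uniq_XYs.
  move=> k; rewrite mem_XYs eqb_id; case: k => * //=; rewrite ?andbF //.
  by apply/esym/andP; split=> //; apply/eqP.
- rewrite cocyclesE => c /mapP[k _ ->]; exact: cocycle_Z2res.
by rewrite cocyclesE -map_comp; exact: H2res_basis.
Qed.
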